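(* Let $m\ge 2$ and $k\ge 1$ be integers and let $n$ be a positive integer divisible by $m-1$. Let $C^m_{k,n}$ be the number of $k$-equivalence classes of $m$-ary parenthesizations of $x_0*x_1*\dots*x_n$. Then $$C^{m}_{k,n}=\sum_{\substack{1\le l\le n\\ (m-1)\mid l}}\frac{l}{n}\sum_{\substack{m_1+\dots+m_k=n\\ m_2+2m_3+\dots+(k-1)m_k=\frac{n-l}{m-1}}}\binom{n}{m_1,\dots,m_k},$$ where the inner sum runs over $k$-tuples of non-negative integers $(m_1,\dots,m_k)$.
   Context: An $m$-ary parenthesization of a block of consecutive symbols is either a single symbol or a bracketed product $(P_1*\dots*P_m)$ of $m$-ary parenthesizations of consecutive blocks which, in order, partition the block. Convention: an unbracketed product $Q_1*\dots*Q_{m+h(m-1)}$ stands for the left-nested bracketing $((\dots((Q_1*\dots*Q_m)*Q_{m+1}*\dots*Q_{2m-1})\dots)*\dots*Q_{m+h(m-1)})$. A $k$-associative step replaces a subexpression $Q_1*\dots*Q_{j-1}*(Q_j*\dots*Q_{j+k(m-1)})*Q_{j+k(m-1)+1}*\dots*Q_{m+k(m-1)}$ (some $1\le j\le m-1$, the $Q_i$ parenthesizations of consecutive blocks) by $Q_1*\dots*Q_j*(Q_{j+1}*\dots*Q_{j+k(m-1)+1})*Q_{j+k(m-1)+2}*\dots*Q_{m+k(m-1)}$. Two parenthesizations are $k$-equivalent if one is obtained from the other by finitely many $k$-associative steps and their inverses. $\binom{n}{m_1,\dots,m_k}$ is the multinomial coefficient. *)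

(* Defs.v *)
From mathcomp Require Import all_boot all_order all_algebra finmap.
From mathcomp Require Import boolp classical_sets functions cardinality.
From Stdlib Require List.
From Stdlib Require Export Relation_Operators.

Set Implicit Arguments.
Unset Strict Implicit.
Unset Printing Implicit Defensive.

Local Open Scope nat_scope.
Local Open Scope classical_set_scope.

(* [Sym i] is the symbol x_i; [Prod [:: P_1; ...; P_r]] is the bracketed
   product (P_1 * ... * P_r). *)
Inductive paren := Sym of nat | Prod of seq paren.

Fixpoint mary (m : nat) (t : paren) : bool :=
  if t is Prod P then (size P == m) && all (mary m) P else true.

Fixpoint symbols (t : paren) : seq nat :=
  match t with
  | Sym i => [:: i]
  | Prod P => flatten [seq symbols p | p <- P]
  end.

Definition parens (m n : nat) : set paren :=
  [set t | mary m t /\ symbols t = iota 0 n.+1].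

(* The left-nested bracketing of Q_1 * ... * Q_{m+h(m-1)}: the first m factors
   are bracketed together first, and h further bracketings follow. *)
Fixpoint lprod (m h : nat) (Q : seq paren) : paren :=
  if h is h'.+1 then lprod m h' (Prod (take m Q) :: drop m Q) else Prod Q.

(* For Q of size m + k(m-1) and j < m, the product
   Q_1 * ... * Q_j * (Q_{j+1} * ... * Q_{j+k(m-1)+1}) * Q_{j+k(m-1)+2} * ...
   with m factors; the inner one has k(m-1)+1 = m + (k-1)(m-1) factors. *)
Definition bracket (m k j : nat) (Q : seq paren) : paren :=
  let w := (k * m.-1).+1 in
  Prod (take j Q ++ lprod m k.-1 (take w (drop j Q)) :: drop (j + w) Q).

Inductive kstep (m k : nat) : paren -> paren -> Prop :=
| kstep_root (j : nat) (Q : seq paren) :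
    size Q = m + k * m.-1 -> 1 <= j <= m.-1 ->
    kstep m k (bracket m k j.-1 Q) (bracket m k j Q)
| kstep_sub (A B : seq paren) (P P' : paren) :
    kstep m k P P' ->
    kstep m k (Prod (A ++ P :: B)) (Prod (A ++ P' :: B)).

(* Intermediate terms are not required to be in [parens m n]; [kequiv_parens]
   shows that this is automatic. *)
Definition kequiv (m k : nat) : paren -> paren -> Prop :=
  clos_refl_sym_trans paren (kstep m k).

Definition kclasses (m k n : nat) : set (set paren) :=
  [set parens m n `&` kequiv m k t | t in parens m n].

(* [fset_set] is only meaningful on finite sets: see [finite_kclasses]. *)
Definition nb_kclasses (m k n : nat) : nat := #|` fset_set (kclasses m k n)|%fset.

(* Exact division when the entries of [e] add up to [n]. *)
Definition multinomial (n k : nat) (e : 'I_k -> nat) : nat :=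
  n`! %/ \prod_(i < k) (e i)`!.

Lemma paren_ind_all (R : paren -> Prop) :
  (forall i, R (Sym i)) ->
  (forall P, List.Forall R P -> R (Prod P)) -> forall t, R t.
Proof.
move=> RS RP; fix IH 1 => -[i|P]; first exact: RS.
by apply: RP; elim: P => [|p P IHP]; constructor.
Qed.

Fixpoint height (t : paren) : nat :=
  if t is Prod P then (foldr maxn 0 [seq height p | p <- P]).+1 else 1.

Lemma finite_seqs (T : Type) (A : set T) (m : nat) : finite_set A ->
  finite_set [set s : seq T | size s = m /\ List.Forall A s].
Proof.
move=> finA; elim: m => [|m IH].
  apply: (@sub_finite_set _ _ [set [::]]); last exact: finite_set1.
  by move=> [|x s] [] //= _ _.
apply: (@sub_finite_set _ _
  [set x :: s | x in A & s in [set s | size s = m /\ List.Forall A s]]).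
  move=> [|x s] [] //= [szs] As; exists x; first by inversion As.
  by exists s => //; split => //; inversion As.
exact: finite_image2.
Qed.

Lemma finite_bounded_height (m : nat) (s : seq nat) (h : nat) :
  finite_set [set t | mary m t /\ {subset symbols t <= s} /\ height t <= h].
Proof.
elim: h => [|h IH].
  apply: (@sub_finite_set _ _ set0); last exact: finite_set0.
  by move=> [i|P] [_ []].
set A := [set t | _] in IH.
apply: (@sub_finite_set _ _ ((Sym @` [set` s]) `|`
  (Prod @` [set P | size P = m /\ List.Forall A P]))).
  move=> [i|P] /= [maryP [subP heightP]].
    by left; exists i => //=; apply: subP; rewrite inE.
  right; exists P => //; move/andP: maryP => [/eqP szP allP]; split => //.
  move: heightP {szP}; rewrite ltnS.
  elim: P subP allP => [|p P IHP] //= subP /andP[mp allP].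
  rewrite geq_max => /andP[hp hP]; constructor.
    by split => //; split => // x xp; apply: subP; rewrite mem_cat xp.
  by apply: IHP => // x xP; apply: subP; rewrite mem_cat xP orbT.
rewrite finite_setU; split; first exact/finite_image/finite_seq.
exact/finite_image/finite_seqs.
Qed.

Lemma height_le_symbols (m : nat) (t : paren) : 1 < m -> mary m t ->
  height t <= size (symbols t).
Proof.
move=> m1; elim/paren_ind_all: t => [i|P IH] //= /andP[/eqP szP allP].
have pos t : mary m t -> 0 < size (symbols t).
  elim/paren_ind_all: t => [//|[|p P'] IH'] /= /andP[/eqP szP' all'].
    by rewrite -szP' in m1.
  move: all' => /andP[mp _]; rewrite size_cat addn_gt0.
  by inversion IH' as [|? ? H]; rewrite H.
have key : foldr maxn 0 (map height P) + (size P).-1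
    <= size (flatten (map symbols P)).
  elim: P {szP} IH allP => [|p P IHP] //= IH /andP[mp allP].
  have hp : height p <= size (symbols p) by inversion IH; auto.
  have {}IHP := IHP (List.Forall_inv_tail IH) allP.
  rewrite size_cat.
  have szP : size P <= size (flatten (map symbols P)).
    elim: P {IH IHP} allP => [|q P IHP] //= /andP[mq allP].
    by rewrite size_cat -addn1 addnC leq_add ?pos ?IHP.
  case: (leqP (height p) (foldr maxn 0 (map height P))) => hm.
    case: P {IH allP} IHP szP hm => [|q P] /= IHP szP hm.
      by rewrite addn0 leqn0 in hm *; rewrite ?(eqP hm) ?leq_addr.
    apply: leq_trans (leq_add (pos _ mp) IHP).
    by rewrite add1n addnS.
  by rewrite leq_add.
apply: leq_trans key; rewrite szP -addn1 leq_add2l.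
by case: (m) m1 => [|[]].
Qed.

Lemma finite_parens (m n : nat) : 1 < m -> finite_set (parens m n).
Proof.
move=> m1; apply: sub_finite_set (finite_bounded_height m (iota 0 n.+1) n.+1).
move=> t [mt st] /=; split=> //; rewrite st; split=> //.
by have := height_le_symbols m1 mt; rewrite st size_iota.
Qed.

Lemma finite_kclasses (m k n : nat) : 1 < m -> finite_set (kclasses m k n).
Proof. by move=> m1; apply/finite_image/finite_parens. Qed.

Lemma symbols_lprod (m h : nat) (Q : seq paren) :
  symbols (lprod m h Q) = flatten (map symbols Q).
Proof.
elim: h Q => [//|h IH] Q; rewrite /= IH /=.
by rewrite -flatten_cat -map_cat cat_take_drop.
Qed.

Lemma mary_lprod (m h : nat) (Q : seq paren) : 0 < m ->
  size Q = m + h * m.-1 -> mary m (lprod m h Q) = all (mary m) Q.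
Proof.
move=> m0; elim: h Q => [|h IH] Q szQ /=.
  by rewrite szQ mul0n addn0 eqxx.
rewrite IH /=; last first.
  by rewrite size_drop szQ mulSn addKn -addSn prednK.
rewrite size_take_min szQ (minn_idPl (leq_addr _ _)) eqxx /=.
by rewrite -all_cat cat_take_drop.
Qed.

Lemma symbols_bracket (m k j : nat) (Q : seq paren) :
  symbols (bracket m k j Q) = flatten (map symbols Q).
Proof.
rewrite /bracket /= map_cat flatten_cat /= symbols_lprod -!flatten_cat.
by rewrite -!map_cat addnC -drop_drop !cat_take_drop.
Qed.

Lemma mary_bracket (m k j : nat) (Q : seq paren) : 0 < m -> 0 < k -> j < m ->
  size Q = m + k * m.-1 -> mary m (bracket m k j Q) = all (mary m) Q.
Proof.
move=> m0 k0 jm szQ; rewrite /bracket /=.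
have wE : (k * m.-1).+1 = m + k.-1 * m.-1.
  by rewrite -(prednK k0) mulSn -addSn prednK.
have szd : (k * m.-1).+1 <= size Q - j.
  by rewrite szQ leq_subRL ?addnS -?addSn ?leq_add2r // ltnW // ltn_addr.
rewrite all_cat /= mary_lprod // ?size_take_min ?size_drop ?(minn_idPl szd) //.
rewrite size_cat /= size_drop size_take_min.
have -> : minn j (size Q) = j by apply/minn_idPl; rewrite szQ ltnW ?ltn_addr.
have -> : (j + (size Q - (j + (k * m.-1).+1)).+1 == m).
  rewrite -subSn; last by rewrite -leq_subRL // szQ ltnW // ltn_addr.
  by rewrite szQ addnS subSS subnDr subnKC // ltnW.
by rewrite -!all_cat addnC -drop_drop !cat_take_drop.
Qed.

Lemma kstep_parens (m k n : nat) (t u : paren) : 1 < m -> 0 < k ->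
  kstep m k t u -> parens m n t <-> parens m n u.
Proof.
move=> m1 k0 tu; rewrite /parens /=.
suff [-> ->] : mary m t = mary m u /\ symbols t = symbols u by [].
elim: tu => {t u} [j Q szQ /andP[j0 jm]|A B P P' _ [mP sP]].
  have m0 := ltnW m1; rewrite !symbols_bracket !mary_bracket //.
    by rewrite -(prednK m0) ltnS.
  by rewrite prednK // (leq_trans jm) ?leq_pred.
by rewrite /= !map_cat !all_cat !size_cat /= mP sP.
Qed.

Lemma kequiv_parens (m k n : nat) (t u : paren) : 1 < m -> 0 < k ->
  kequiv m k t u -> parens m n t <-> parens m n u.
Proof.
move=> m1 k0; elim=> {t u} [t u|//|t u _ [? ?]|t u v _ [? ?] _ [? ?]].
- exact: kstep_parens.
- by split.
- by split; auto.
Qed.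

(* Main.v *)
Require Import Defs.
From mathcomp Require Import all_boot all_order all_algebra zify.
From mathcomp Require finmap boolp classical_sets cardinality.
Import GRing.Theory Num.Theory.
Set Implicit Arguments.
Unset Strict Implicit.
Unset Printing Implicit Defensive.

(* Record, for each symbol of a parenthesization, the number of brackets that
   open just before it. This is Polish notation, so it determines the tree, and
   a sequence of numbers occurs iff every suffix is longer than [m - 1] times
   its sum (with difference one for the whole sequence). A k-associative step
   moves [k] opening brackets from one symbol to a later one, so the numbers
   modulo [k] are invariant. Conversely, as long as a symbol other than the
   first is preceded by at least [k] opening brackets, an inverse step moves
   them to the left; hence each class contains exactly one tree whose numbers,
   the first excepted, are smaller than [k]. The classes are thus counted by
   the words over [0, k) with the suffix property, and the cycle lemma gives
   the proportion [l / n] of these among all words with a given sum. *)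

(** * Words over the letters below [k] *)

Fixpoint words (k n : nat) : seq (seq nat) :=
  if n is n'.+1 then [seq a :: w | a <- iota 0 k, w <- words k n']
  else [:: [::]].

Lemma mem_words (k n : nat) (w : seq nat) :
  (w \in words k n) = (size w == n) && all (fun a => a < k) w.
Proof.
elim: n w => [|n IH] [|a w] //=.
  by apply/allpairsP => -[[b v] []].
rewrite eqSS; apply/allpairsP/and3P => [[[b v] /= [bk vW [-> ->]]]|[sw ak aw]].
  by move: bk vW; rewrite mem_iota IH add0n => /= -> /andP[].
by exists (a, w); rewrite mem_iota IH /= add0n sw aw ak.
Qed.

Lemma size_words (k n : nat) (w : seq nat) : w \in words k n -> size w = n.
Proof. by rewrite mem_words => /andP[/eqP]. Qed.

Lemma uniq_words (k n : nat) : uniq (words k n).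
Proof.
elim: n => [//|n IH] /=; apply: allpairs_uniq => //; first exact: iota_uniq.
by move=> [a w] [b v] _ _ /= [-> ->].
Qed.

Lemma sum_words0 (k : nat) (F : seq nat -> nat) :
  \sum_(w <- words k 0) F w = F [::].
Proof. by rewrite big_seq1. Qed.

Lemma sum_wordsS (k n : nat) (F : seq nat -> nat) :
  \sum_(w <- words k n.+1) F w =
  \sum_(a < k) \sum_(w <- words k n) F (val a :: w).
Proof. by rewrite /= big_allpairs_dep -[k in iota 0 k]subn0 -/(index_iota _ _) big_mkord. Qed.

(* The [n + 1] letters of a word contribute equally to its sum. *)
Lemma sum_words_head (k n : nat) (F : nat -> nat) :
  n.+1 * \sum_(a < k) \sum_(w <- words k n) a * F (a + sumn w) =
  \sum_(w <- words k n.+1) sumn w * F (sumn w).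
Proof.
elim: n F => [|n IH] F.
  by rewrite mul1n sum_wordsS; apply: eq_bigr => a _; rewrite !sum_words0 /= addn0.
rewrite [RHS]sum_wordsS.
under [RHS]eq_bigr => a _ do under eq_bigr => w _ do rewrite /= mulnDl.
under [RHS]eq_bigr => a _ do
  rewrite big_split /= -(IH (fun s => F (a + s))).
rewrite big_split /= mulSn; congr (_ + _).
rewrite -big_distrr /= [in RHS]exchange_big; congr (_ * _).
apply: eq_bigr => b _; rewrite sum_wordsS.
by apply: eq_bigr => a _; apply: eq_bigr => w _ /=; rewrite addnCA.
Qed.

(** * Ballot words and the cycle lemma *)

(** For [d = m.-1], strictness means that reading a code from right to left leaves at least one tree
    on the stack after each entry. *)
Fixpoint ballot (d : nat) (s : seq nat) : bool :=
  if s is _ :: s' then (d * sumn s < size s) && ballot d s' else true.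

(* For [n - d * sumn w > 0] this is the cycle lemma; otherwise both
   coefficients vanish, the one on the right by truncation. *)
Lemma sum_ballot_words (d k n : nat) (F : nat -> nat) :
  n * \sum_(w <- words k n) ballot d w * F (sumn w) =
  \sum_(w <- words k n) (n - d * sumn w) * F (sumn w).
Proof.
elim: n F => [|n IH] F; first by rewrite mul0n sum_words0.
(* The argument below cancels a factor [n], so words of length one are treated directly. *)
have [->|n0] := posnP n.
  rewrite mul1n !sum_wordsS. apply: eq_bigr => a _.
  rewrite !sum_words0 /= addn0 andbT. by case: (d * a).
(* [H] absorbs the ballot inequality of the whole word of length [n.+1]; what remains is the
   condition on the tail, to which [IH] applies. *)
pose H s := (d * s <= n) * F s.
apply/eqP; rewrite -(eqn_pmul2l n0) mulnCA; apply/eqP.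
have -> : n * \sum_(w <- words k n.+1) ballot d w * F (sumn w) =
    \sum_(w <- words k n.+1) (n - d * sumn w) * H (sumn w) +
    d * \sum_(a < k) \sum_(w <- words k n) a * H (a + sumn w).
  rewrite !sum_wordsS !big_distrr -big_split /=; apply: eq_bigr => a _.
  rewrite !big_distrr -big_split /=.
  transitivity (n * \sum_(w <- words k n) ballot d w * H (a + sumn w)).
    rewrite big_distrr /=; apply: eq_big_seq => w /size_words ->.
    by rewrite ltnS /H; case: (_ <= n); case: (ballot d w); rewrite ?mul1n ?mul0n.
  (* Where [H] does not vanish, [n - d * sumn w] splits into [n - d * (a + sumn w)], which depends
     on the total sum only, and [d * a], linear in the first letter. *)
  rewrite (IH (fun s => H (a + s))); apply: eq_bigr => w _.
  rewrite /H; case: leqP => h; last by rewrite !(mul0n, muln0).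
  rewrite !mul1n mulnA -mulnDl; congr (_ * _); nia.
(* After averaging the first letter over all positions, it remains that [n.+1 * (n - d * s) + d * s
   = n * (n.+1 - d * s)] for [d * s <= n]. *)
rewrite mulnDr mulnCA sum_words_head !big_distrr -big_split /=.
apply: eq_bigr => w _; rewrite !mulnA -mulnDl /H.
case: leqP => h; last by rewrite (_ : n.+1 - _ = 0) ?muln0 //; lia.
rewrite !muln1; congr (_ * _); nia.
Qed.

(** * Words with prescribed content *)

Lemma prod_fact_decr (k : nat) (e : 'I_k -> nat) (a : 'I_k) : 0 < e a ->
  \prod_(i < k) (e i)`! = e a * \prod_(i < k) (e i - (i == a))`!.
Proof.
move=> ea; rewrite (bigD1 a) //= [in RHS](bigD1 a) //= eqxx mulnA subn1.
rewrite -[in LHS](prednK ea) factS prednK //; congr (_ * _).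
by apply: eq_bigr => i /negPf ->; rewrite subn0.
Qed.

(** Induction on the length, splitting [n.+1] as the sum of the [e a]: a word starting with [a] has
    a tail whose content is [e] lowered by one at [a], and the factor [e a] comes out of the
    factorial. *)
Lemma count_words_content (k n : nat) (e : 'I_k -> nat) : \sum_(i < k) e i = n ->
  (\sum_(w <- words k n) [forall i : 'I_k, count_mem (val i) w == e i])
    * \prod_(i < k) (e i)`! = n`!.
Proof.
elim: n e => [|n IH] e se.
  have e0 (i : 'I_k) : e i = 0.
    by apply/eqP; move/eqP: se; rewrite sum_nat_eq0 => /forallP/(_ i).
  rewrite sum_words0 (_ : [forall i, _] = true) ?mul1n.
    by rewrite big1 // => i _; rewrite e0.
  by apply/forallP => i; rewrite e0.
rewrite sum_wordsS big_distrl /= factS -se big_distrl /=.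
apply: eq_bigr => a _; have [ea|ea] := posnP (e a).
  rewrite big1 ?ea // => w _; case: forallP => // /(_ a).
  by rewrite ea /= eqxx.
rewrite (prod_fact_decr ea) mulnCA; congr (_ * _).
pose e' i := e i - (i == a).
rewrite -(IH e'); last first.
  apply/eqP; rewrite -eqSS -se [in X in _ == X](bigD1 a) //= (bigD1 a) //= {1}/e' eqxx.
  rewrite subn1 -addSn prednK //; apply/eqP; congr (_ + _).
  by apply: eq_bigr => i /negPf; rewrite /e' => ->; rewrite subn0.
congr (_ * _); apply: eq_bigr => w _; congr (nat_of_bool _).
apply: eq_forallb => i; rewrite /e' /= (eq_sym i) val_eqE.
by case: (a =P i) => [<-|_] /=; [apply/eqP/eqP; lia|rewrite add0n subn0].
Qed.

Lemma sum_count_mem (k : nat) (w : seq nat) (F : nat -> nat) :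
  all (fun a => a < k) w ->
  \sum_(i < k) F i * count_mem (val i) w = \sum_(a <- w) F a.
Proof.
elim: w => [|a w IH] /=; first by rewrite big_nil big1 // => i; rewrite muln0.
move=> /andP[ak /IH {}IH]; rewrite big_cons -IH.
under eq_bigr do rewrite mulnDr.
rewrite big_split /=; congr (_ + _).
rewrite (bigD1 (Ordinal ak)) //= eqxx muln1 big1 ?addn0 // => i.
by rewrite -val_eqE /= eq_sym => /negPf ->; rewrite muln0.
Qed.

(** * Polish codes of parenthesizations *)

Definition bump (a : nat) (s : seq (nat * nat)) : seq (nat * nat) :=
  if s is (i, b) :: s' then (i, a + b) :: s' else [::].

(* The pairs (symbol, number of brackets opening just before it). *)
Fixpoint code (t : paren) : seq (nat * nat) :=
  match t with
  | Sym i => [:: (i, 0)]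
  | Prod P => bump 1 (flatten [seq code p | p <- P])
  end.

Definition codes (P : seq paren) := flatten [seq code p | p <- P].

Definition opens (t : paren) : seq nat := unzip2 (code t).

Lemma codes_cat (P Q : seq paren) : codes (P ++ Q) = codes P ++ codes Q.
Proof. by rewrite /codes map_cat flatten_cat. Qed.

Lemma codes_cons (p : paren) (P : seq paren) : codes (p :: P) = code p ++ codes P.
Proof. by []. Qed.

Lemma size_bump (a : nat) (s : seq (nat * nat)) : size (bump a s) = size s.
Proof. by case: s => [//|[]]. Qed.

Lemma bump_bump (a b : nat) (s : seq (nat * nat)) :
  bump a (bump b s) = bump (a + b) s.
Proof. by case: s => [//|[i c] s] /=; rewrite addnA. Qed.

Lemma bump_cat (a : nat) (s s' : seq (nat * nat)) : 0 < size s ->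
  bump a (s ++ s') = bump a s ++ s'.
Proof. by case: s => [//|[]]. Qed.

Lemma unzip1_bump (a : nat) (s : seq (nat * nat)) :
  unzip1 (bump a s) = unzip1 s.
Proof. by case: s => [//|[]]. Qed.

Lemma symbols_code (t : paren) : symbols t = unzip1 (code t).
Proof.
elim/paren_ind_all: t => [//|P IH] /=; rewrite unzip1_bump.
elim: IH => [//|p {}P Hp _ IH] /=.
by rewrite Hp IH /unzip1 map_cat.
Qed.

(* Evaluation of the code in Polish notation, read from right to left with a
   stack of trees. *)
Fixpoint parse (m : nat) (z : seq (nat * nat)) (S : seq paren) : seq paren :=
  if z is (i, a) :: z' then
    iter a (fun S => Prod (take m S) :: drop m S) (Sym i :: parse m z' S)
  else S.

Lemma parse_cat (m : nat) (z z' : seq (nat * nat)) (S : seq paren) :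
  parse m (z ++ z') S = parse m z (parse m z' S).
Proof. by elim: z => [//|[i a] z IH] /=; rewrite IH. Qed.

Lemma parse_bump (m : nat) (z : seq (nat * nat)) (S : seq paren) : 0 < size z ->
  parse m (bump 1 z) S = Prod (take m (parse m z S)) :: drop m (parse m z S).
Proof. by case: z => [|[i a] z]. Qed.

Lemma size_code_gt0 (m : nat) (t : paren) : 0 < m -> mary m t -> 0 < size (code t).
Proof.
move=> m0; elim/paren_ind_all: t => [//|P IH] /= /andP[/eqP sP aP].
rewrite size_bump; case: P sP IH aP => [|p P] /= sP IH; first by rewrite -sP in m0.
by move=> /andP[mp _]; rewrite size_cat addn_gt0 (List.Forall_inv IH).
Qed.

Lemma size_codes (m : nat) (P : seq paren) : 0 < m -> all (mary m) P ->
  size P <= size (codes P).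
Proof.
move=> m0; elim: P => [//|p P IH] /= /andP[mp /IH hP].
rewrite codes_cons size_cat.
by have := size_code_gt0 m0 mp; lia.
Qed.

Lemma parse_code (m : nat) (t : paren) (S : seq paren) : 0 < m -> mary m t ->
  parse m (code t) S = t :: S.
Proof.
move=> m0; elim/paren_ind_all: t S => [//|P IH] S /= /andP[/eqP sP aP].
have E : parse m (codes P) S = P ++ S.
  elim: IH S aP {sP} => [//|p {}P Hp _ IH] S /= /andP[mp aP].
  by rewrite codes_cons parse_cat IH // Hp.
rewrite parse_bump; last by have := size_codes m0 aP; rewrite sP; apply: leq_trans.
by rewrite -/(codes P) E -sP take_size_cat // drop_size_cat.
Qed.

Lemma code_inj (m : nat) (t u : paren) : 0 < m -> mary m t -> mary m u ->
  code t = code u -> t = u.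
Proof.
by move=> m0 mt mu e; have := parse_code [::] m0 mt; rewrite e parse_code // => -[].
Qed.

(** A suffix that meets [s] contains all of [s'], and the two strict inequalities add up. *)
Lemma ballot_cat (d : nat) (s s' : seq nat) :
  ballot d s -> ballot d s' -> ballot d (s ++ s').
Proof.
move=> bs bs'; elim: s bs => [//|a s IH] /= /andP[lt /IH ->]; rewrite andbT.
rewrite sumn_cat size_cat; case: s' bs' {IH} => [|b s'] /=; first by lia.
by move=> /andP[lt' _]; lia.
Qed.

Lemma ballot_bump (d : nat) (s : seq (nat * nat)) :
  d * (sumn (unzip2 s)).+1 < size s -> ballot d (unzip2 s) ->
  ballot d (unzip2 (bump 1 s)).
Proof.
case: s => [//|[i a] s] /= lt /andP[_ ->]; rewrite size_map in lt *.
by rewrite andbT; lia.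
Qed.

Lemma sumn_bump (a : nat) (s : seq (nat * nat)) : 0 < size s ->
  sumn (unzip2 (bump a s)) = a + sumn (unzip2 s).
Proof. by case: s => [//|[i b] s] _ /=; rewrite addnA. Qed.

Lemma unzip2_cat (s s' : seq (nat * nat)) :
  unzip2 (s ++ s') = unzip2 s ++ unzip2 s'.
Proof. exact: map_cat. Qed.

(** Each tree has excess one of length over [m.-1] times the sum. The [m] factors of a product have
    excess [m] together, which the new bracket lowers to one. *)
Lemma code_ballot (m : nat) (t : paren) : 1 < m -> mary m t ->
  size (code t) = (m.-1 * sumn (opens t)).+1 /\ ballot m.-1 (opens t).
Proof.
move=> m1; have m0 := ltnW m1.
elim/paren_ind_all: t => [i|P IH]; first by rewrite /= muln0.
move=> /= /andP[/eqP sP aP].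
have [sz bal] : size (codes P) = m.-1 * sumn (unzip2 (codes P)) + size P /\
    ballot m.-1 (unzip2 (codes P)).
  elim: IH aP {sP} => [|p {}P Hp _ IH] /=; first by rewrite muln0.
  move=> /andP[/Hp[sp bp] /IH[sP bP]].
  rewrite codes_cons unzip2_cat; split; last exact: ballot_cat.
  by rewrite size_cat sumn_cat sp sP /opens; lia.
have pos : 0 < size (codes P) by have := size_codes m0 aP; rewrite sP; apply: leq_trans.
rewrite /opens /= -/(codes P) size_bump sumn_bump //; split; first by rewrite sz sP; lia.
by apply: ballot_bump => //; rewrite sz sP; lia.
Qed.

(* Under the ballot condition the stack is never too short for a reduction. *)
Lemma parse_ballot (m : nat) (z : seq (nat * nat)) : 1 < m ->
  ballot m.-1 (unzip2 z) ->
  [/\ all (mary m) (parse m z [::]), codes (parse m z [::]) = z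
    & size (parse m z [::]) + m.-1 * sumn (unzip2 z) = size z].
Proof.
move=> m1; have m0 := ltnW m1; elim: z => [|[i a] z IH] /=; first by rewrite muln0.
move=> /andP[lt /IH[mP cP sP]]; move: (parse _ _ _) => S in mP cP sP *.
rewrite size_map in lt.
(* Each of the [a] reductions shortens the stack by [m.-1], and one tree must survive. *)
have : m.-1 * a < (size S).+1 by lia.
elim: a {lt} => [_|a IHa lt] /=; first by split=> //; [rewrite codes_cons cP|lia].
have [|mS cS sS] := IHa; first by lia.
move: (iter _ _ _) => R in mS cS sS *.
have leR : m <= size R by lia.
split.
- by rewrite /= size_takel // eqxx -all_cat cat_take_drop.
- rewrite codes_cons /= -/(codes _) -bump_cat -?codes_cat ?cat_take_drop ?cS //.
  apply: leq_trans (size_codes m0 _); first by rewrite size_takel.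
  by move: mS; rewrite -{1}(cat_take_drop m R) all_cat => /andP[].
- by rewrite /= size_drop; lia.
Qed.

(** Excess one forces the final stack of [parse] to hold a single tree. *)
Lemma ballot_code (m : nat) (z : seq (nat * nat)) : 1 < m ->
  ballot m.-1 (unzip2 z) -> size z = (m.-1 * sumn (unzip2 z)).+1 ->
  exists2 t, mary m t & code t = z.
Proof.
move=> m1 /(parse_ballot m1)[]; case: (parse m z [::]) => [|t [|? ?]] /=; try lia.
rewrite andbT => mt cz _ _; exists t => //.
by rewrite -[RHS]cz codes_cons cats0.
Qed.

(** * Effect of k-associative steps on codes *)

(** All [h.+1] brackets of a left comb open before its first symbol. *)
Lemma code_lprod (m h : nat) (Q : seq paren) : 0 < m -> m <= size Q ->
  all (mary m) Q -> size Q = m + h * m.-1 ->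
  code (lprod m h Q) = bump h.+1 (codes Q).
Proof.
move=> m0; elim: h Q => [//|h IH] Q leQ aQ szQ /=.
have [aT aD] : all (mary m) (take m Q) /\ all (mary m) (drop m Q).
  by apply/andP; rewrite -all_cat cat_take_drop.
have sT : size (take m Q) = m by rewrite size_takel.
rewrite IH /= ?aD ?sT ?eqxx ?aT ?size_drop //; try lia.
rewrite codes_cons /= -/(codes _) -bump_cat -?codes_cat ?cat_take_drop ?bump_bump ?addn1 //.
by apply: leq_trans (size_codes m0 aT); rewrite sT.
Qed.

(** The inner comb consists of [k] brackets, all opening where the factor after the first [j]
    begins; so [j] affects only the place of these [k] brackets. *)
Lemma code_bracket (m k j : nat) (Q : seq paren) : 0 < m -> 0 < k -> j < m ->
  size Q = m + k * m.-1 -> all (mary m) Q ->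
  code (bracket m k j Q) = bump 1 (codes (take j Q) ++ bump k (codes (drop j Q))).
Proof.
move=> m0 k0 jm szQ aQ; rewrite /bracket /= -/(codes _) codes_cat codes_cons.
have wE : (k * m.-1).+1 = m + k.-1 * m.-1 by nia.
have aD : all (mary m) (drop j Q).
  by move: aQ; rewrite -{1}(cat_take_drop j Q) all_cat => /andP[].
set w := (k * m.-1).+1 in wE *.
have sT : size (take w (drop j Q)) = w by rewrite size_takel // size_drop; nia.
have aT : all (mary m) (take w (drop j Q)).
  by move: aD; rewrite -{1}(cat_take_drop w (drop j Q)) all_cat => /andP[].
have -> : code (lprod m k.-1 (take w (drop j Q))) =
    bump k (codes (take w (drop j Q))).
  by rewrite code_lprod ?sT ?prednK // wE leq_addr.
rewrite -bump_cat.
  by rewrite -codes_cat addnC -drop_drop cat_take_drop.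
by apply: leq_trans (size_codes m0 aT); rewrite sT.
Qed.

Lemma unzip2_bump_mod (k a : nat) (s s' : seq (nat * nat)) :
  [seq b %% k | b <- unzip2 s] = [seq b %% k | b <- unzip2 s'] ->
  [seq b %% k | b <- unzip2 (bump a s)] = [seq b %% k | b <- unzip2 (bump a s')].
Proof.
case: s s' => [|[i b] s] [|[i' b'] s'] //= [e ->]; congr (_ :: _).
by rewrite -modnDmr e modnDmr.
Qed.

Lemma unzip2_bumpk_mod (k : nat) (s : seq (nat * nat)) :
  [seq b %% k | b <- unzip2 (bump k s)] = [seq b %% k | b <- unzip2 s].
Proof. by case: s => [|[i b] s] //=; rewrite modnDl. Qed.

(** The right-hand side is free of [j], so both ends of a root step have the same residues. *)
Lemma opens_bracket_mod (m k j : nat) (Q : seq paren) : 0 < m -> 0 < k -> j < m ->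
  size Q = m + k * m.-1 -> all (mary m) Q ->
  [seq b %% k | b <- opens (bracket m k j Q)] =
  [seq b %% k | b <- unzip2 (bump 1 (codes Q))].
Proof.
move=> m0 k0 jm szQ aQ; rewrite /opens code_bracket //; apply: unzip2_bump_mod.
rewrite unzip2_cat map_cat unzip2_bumpk_mod -map_cat -unzip2_cat -codes_cat.
by rewrite cat_take_drop.
Qed.

Lemma kstep_opens_mod (m k : nat) (t u : paren) : 1 < m -> 0 < k ->
  kstep m k t u -> mary m t ->
  [seq a %% k | a <- opens t] = [seq a %% k | a <- opens u].
Proof.
move=> m1 k0; have m0 := ltnW m1.
elim=> {t u} [j Q szQ /andP[j0 jm]|A B P P' _ IH].
  have jm' : j < m by lia.
  rewrite mary_bracket // ?(leq_ltn_trans (leq_pred _)) // => aQ.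
  by rewrite !opens_bracket_mod // (leq_ltn_trans (leq_pred _)).
rewrite /= all_cat /= => /and4P[_ _ /IH e _].
apply: unzip2_bump_mod; rewrite -!/(codes _) !codes_cat !codes_cons.
by rewrite !unzip2_cat !map_cat -!/(opens _) e.
Qed.

Lemma kequiv_opens_mod (m k n : nat) (t u : paren) : 1 < m -> 0 < k ->
  kequiv m k t u -> parens m n t ->
  [seq a %% k | a <- opens t] = [seq a %% k | a <- opens u].
Proof.
move=> m1 k0; elim=> {t u} [t u tu [mt _]|//|t u tu IH pu|t u v tu IH uv IH' pt].
- exact: kstep_opens_mod tu mt.
- by rewrite IH //; apply/(kequiv_parens n m1 k0 tu).
- by rewrite IH // IH' //; apply/(kequiv_parens n m1 k0 tu).
Qed.

(** * Descent to a normal form *)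

(* [\sum_i i * s_i], written as the sum of the sums of all proper suffixes. *)
Fixpoint moment (s : seq nat) : nat :=
  if s is _ :: s' then sumn s' + moment s' else 0.

Lemma moment_cat (s s' : seq nat) :
  moment (s ++ s') = moment s + moment s' + size s * sumn s'.
Proof. by elim: s => [|a s IH] /=; rewrite ?sumn_cat ?IH; lia. Qed.

Lemma moment_bump (a : nat) (s : seq (nat * nat)) :
  moment (unzip2 (bump a s)) = moment (unzip2 s).
Proof. by case: s => [|[]]. Qed.

(** The [k] inner brackets sit at the symbol whose index is the number of symbols in the first [j]
    factors; moving them left lowers the moment. *)
Lemma moment_bracket (m k j : nat) (Q : seq paren) : 0 < m -> 0 < k -> j < m ->
  size Q = m + k * m.-1 -> all (mary m) Q ->
  moment (opens (bracket m k j Q)) =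
  moment (unzip2 (codes Q)) + size (codes (take j Q)) * k.
Proof.
move=> m0 k0 jm szQ aQ; rewrite /opens code_bracket // moment_bump.
rewrite -[in X in moment (unzip2 (codes X))](cat_take_drop j Q) codes_cat.
rewrite !unzip2_cat !moment_cat moment_bump sumn_bump ?size_map; first by lia.
apply: leq_trans (size_codes m0 _); first by rewrite size_drop; lia.
by move: aQ; rewrite -{1}(cat_take_drop j Q) all_cat => /andP[].
Qed.

(** [lprod] is built from its innermost bracket outwards, whereas the recursion on trees in
    [lprod_of_opens] meets the outermost bracket first. *)
Lemma lprod_cons (m h : nat) (Q P : seq paren) : m <= size Q ->
  size Q = m + h * m.-1 -> 0 < m ->
  Prod (lprod m h Q :: P) = lprod m h.+1 (Q ++ P).
Proof.
elim: h Q => [|h IH] Q leQ szQ m0.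
  by rewrite /= take_size_cat ?drop_size_cat //; lia.
rewrite [lprod m h.+1 Q]/= IH /= ?size_drop //; try lia.
rewrite takel_cat // drop_cat; case: ltnP => // geQ.
by rewrite [drop m Q]drop_oversize // (_ : m - size Q = 0) ?drop0 //; lia.
Qed.

(* The brackets opening just before the first symbol of a tree form a left
   comb at its root. *)
Lemma lprod_of_opens (m h : nat) (t : paren) : 0 < m -> mary m t ->
  h < head 0 (opens t) ->
  exists Q, [/\ t = lprod m h Q, size Q = m + h * m.-1 & all (mary m) Q].
Proof.
move=> m0; elim: h t => [|h IH] [i|P] //= /andP[/eqP sP aP].
  by exists P; rewrite mul0n addn0.
case: P sP aP => [|p P] /= sP; first by rewrite -sP in m0.
move=> /andP[mp aP]; rewrite /opens /= bump_cat ?(size_code_gt0 m0) //.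
move=> hp; have [|Q [pE sQ aQ]] := IH p mp.
  by have := size_code_gt0 m0 mp; move: hp; rewrite /opens; case: (code p) => [|[]].
exists (Q ++ P); split; last by rewrite all_cat aQ.
- by rewrite pE lprod_cons // sQ leq_addr.
- by rewrite size_cat sQ; lia.
Qed.

Lemma all_flatten_mapN (T U : Type) (f : pred U) (g : T -> seq U) (P : seq T) :
  ~~ all f (flatten (map g P)) ->
  exists A p B, P = A ++ p :: B /\ ~~ all f (g p).
Proof.
elim: P => [//|p P IH] /=; rewrite all_cat negb_and => /orP[np|].
  by exists [::], p, P.
by move=> /IH[A [q [B [-> nq]]]]; exists (p :: A), q, B.
Qed.

Lemma kstep_mary_symbols (m k : nat) (t u : paren) : 1 < m -> 0 < k ->
  kstep m k t u -> mary m t = mary m u /\ symbols t = symbols u.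
Proof.
move=> m1 k0; have m0 := ltnW m1.
elim=> {t u} [j Q szQ jm|A B P P' _ [mP sP]].
  by rewrite !symbols_bracket !mary_bracket //; lia.
by rewrite /= !map_cat !all_cat !size_cat /= mP sP.
Qed.

(** The moment of the whole depends on a factor only through its length, sum and moment, and a step
    keeps the first two. *)
Lemma kstep_sub_moment (m k : nat) (A B : seq paren) (p u : paren) :
  1 < m -> 0 < k -> mary m p -> kstep m k u p ->
  moment (opens u) < moment (opens p) ->
  moment (opens (Prod (A ++ u :: B))) < moment (opens (Prod (A ++ p :: B))).
Proof.
move=> m1 k0 mp up lt; have [mu su] := kstep_mary_symbols m1 k0 up.
rewrite mp in mu; have [szp _] := code_ballot m1 mp.
have [szu _] := code_ballot m1 mu.
have sz : size (code u) = size (code p).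
  by rewrite -!(size_map fst) -!/(unzip1 _) -!symbols_code su.
have sum : sumn (opens u) = sumn (opens p).
  apply/eqP; have m2 : 0 < m.-1 by lia.
  by rewrite -(eqn_pmul2l m2) -eqSS -szu -szp sz.
rewrite /opens /= !moment_bump -!/(codes _) !codes_cat !codes_cons !unzip2_cat.
rewrite -!/(opens _) !moment_cat !sumn_cat sum !size_map sz; lia.
Qed.


(** A large entry either lies inside a factor, away from its first symbol, and induction applies, or
    stands at the start of a factor other than the first. Such a factor begins with a comb of [k]
    brackets, which an inverse root step moves left past the preceding factor. *)
Lemma kstep_descent (m k : nat) (t : paren) : 1 < m -> 0 < k -> mary m t ->
  ~~ all (fun a => a < k) (behead (opens t)) ->
  exists2 u, kstep m k u t & moment (opens u) < moment (opens t).
Proof.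
move=> m1 k0; have m0 := ltnW m1.
elim/paren_ind_all: t => [//|P IH] mP nP.
have := mP; rewrite [X in X -> _]/= => /andP[/eqP sP aP].
have inner A p B : P = A ++ p :: B -> ~~ all (fun a => a < k) (behead (opens p)) ->
    exists2 u, kstep m k u (Prod P) & moment (opens u) < moment (opens (Prod P)).
  move=> PE np; move: IH aP; rewrite PE => /List.Forall_app[_ IH].
  rewrite all_cat => /and3P[_ mp _].
  have [u up lt] := List.Forall_inv IH mp np.
  exists (Prod (A ++ u :: B)); first exact: kstep_sub.
  exact: (kstep_sub_moment _ _ m1 k0 mp up).
case: P => [|p0 P] in IH mP nP sP aP inner *; first by [].
have p0pos : 0 < size (code p0) by move: aP => /= /andP[/(size_code_gt0 m0)].
(* Only the first factor loses its first entry; the others contribute all of theirs. *)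
have : ~~ all (fun a => a < k) (behead (opens p0) ++ flatten (map opens P)).
  have -> : flatten (map opens P) = unzip2 (codes P).
    by rewrite /unzip2 map_flatten -map_comp.
  move: nP p0pos; rewrite /opens /= -/(codes _).
  by case: (code p0) => [//|[i a] z] /=; rewrite unzip2_cat.
rewrite all_cat negb_and => /orP[|/all_flatten_mapN[A [p [B [PE np]]]]].
  exact: (inner [::]).
have [hp|hp] := ltnP (head 0 (opens p)) k.
  apply: (inner (p0 :: A) p B); first by rewrite PE.
  by move: hp np; case: (opens p) => [|a s] //= ->.
have mp : mary m p by move: aP; rewrite PE /= all_cat /= => /and4P[].
have [|Q [pE sQ aQ]] := lprod_of_opens (h := k.-1) m0 mp; first by rewrite prednK.
have {}sQ : size Q = (k * m.-1).+1 by rewrite sQ; nia.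
(* Isolates the factor [q] just before [p]; it exists because [p] comes after [p0]. *)
have PE' : p0 :: P = belast p0 A ++ last p0 A :: p :: B.
  by rewrite PE -cat_cons lastI cat_rcons.
move: (belast p0 A) (last p0 A) PE' => C q PE'; rewrite {}PE' in sP aP *.
pose R := C ++ q :: Q ++ B.
have RE : R = rcons C q ++ Q ++ B by rewrite cat_rcons.
have sR : size R = m + k * m.-1.
  by move: sP; rewrite /R !size_cat /= size_cat sQ; lia.
have aR : all (mary m) R.
  by move: aP; rewrite /R !all_cat /= all_cat aQ => /and4P[-> -> _ ->].
have jm : (size C).+1 <= m.-1 by move: sP; rewrite size_cat /=; lia.
have dR : drop (size C).+1 R = Q ++ B.
  by rewrite RE -(size_rcons C q) drop_size_cat.
have tE : Prod (C ++ q :: p :: B) = bracket m k (size C).+1 R.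
  rewrite /bracket addnC -drop_drop dR -sQ take_size_cat // drop_size_cat //.
  by rewrite RE -(size_rcons C q) take_size_cat // cat_rcons -pE.
rewrite tE; exists (bracket m k (size C) R); first exact: (kstep_root (j := (size C).+1)).
(* The moments differ by [k] times the number of symbols of [q]. *)
rewrite !moment_bracket //; try lia.
rewrite ltn_add2l ltn_pmul2r // [take (size C) R]take_size_cat //.
rewrite RE -(size_rcons C q) take_size_cat // -cats1 codes_cat size_cat codes_cons size_cat.
have : 0 < size (code q).
  by move: aP; rewrite all_cat /= => /and4P[_ /(size_code_gt0 m0)].
lia.
Qed.

(** The descent stops because the moment, bounded by [N], drops each time. *)
Lemma normal_form (m k n : nat) (t : paren) : 1 < m -> 0 < k -> parens m n t ->
  exists u, [/\ kequiv m k t u, parens m n u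
              & all (fun a => a < k) (behead (opens u))].
Proof.
move=> m1 k0; move: {2}(moment _) (leqnn (moment (opens t))) => N.
elim: N t => [|N IH] t leN pt.
  exists t; split=> //; first exact: rst_refl.
  by apply: contraT => /(kstep_descent m1 k0 pt.1)[u _]; lia.
case: (boolP (all (fun a => a < k) (behead (opens t)))) => [|/kstep_descent] at_.
  by exists t; split=> //; exact: rst_refl.
have [//|//||u ut lt] := at_ m; first exact: pt.1.
have [|v [uv pv av]] := IH u _ ((kstep_parens n m1 k0 ut).2 pt); first by lia.
exists v; split=> //; apply: rst_trans uv; apply: rst_sym; exact: rst_step.
Qed.

(** * Equivalence classes as ballot words *)

Lemma size_opens (m n : nat) (t : paren) : parens m n t -> size (opens t) = n.+1.
Proof.
by move=> [_ st]; rewrite size_map -(size_map fst) -/(unzip1 _) -symbols_code st size_iota.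
Qed.

(** The total number of brackets is [n %/ m.-1], so the first entry is determined by the rest; hence
    words of length [n], not [n.+1]. *)
Lemma opens_parens (m n : nat) (t : paren) : 1 < m -> parens m n t ->
  opens t = n %/ m.-1 - sumn (behead (opens t)) :: behead (opens t).
Proof.
move=> m1 pt; have [sz _] := code_ballot m1 pt.1.
have := size_opens pt; rewrite size_map sz => -[<-].
rewrite mulKn; last by lia.
by case: (opens t) (size_opens pt) => [//|a s] _ /=; rewrite addnK.
Qed.

Lemma parens_inj (m n : nat) (t u : paren) : 1 < m ->
  parens m n t -> parens m n u -> behead (opens t) = behead (opens u) -> t = u.
Proof.
move=> m1 pt pu e; apply: (code_inj (ltnW m1) pt.1 pu.1).
rewrite -[LHS]zip_unzip -[RHS]zip_unzip -!symbols_code pt.2 pu.2 -!/(opens _).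
by rewrite (opens_parens m1 pt) (opens_parens m1 pu) e.
Qed.

Lemma parens_of_word (m k n : nat) (w : seq nat) : 1 < m -> 0 < n ->
  m.-1 %| n -> w \in words k n -> ballot m.-1 w ->
  exists2 t, parens m n t & behead (opens t) = w.
Proof.
move=> m1 n0 dn wW bw; have sw := size_words wW.
have lt : m.-1 * sumn w < n.
  by case: w bw sw {wW} => [_ _|a w /andP[lt _] <- //]; rewrite /= muln0.
have m2 : 0 < m.-1 by lia.
have [q nE] := dvdnP dn.
(* The prepended entry brings the sum to [q]; by [lt] the subtraction is not truncated. *)
pose o := q - sumn w :: w; pose z := zip (iota 0 n.+1) o.
have zo : unzip2 z = o by rewrite unzip2_zip // size_iota /= sw.
have so : m.-1 * sumn o = n by rewrite /=; nia.
have [||t mt ct] := @ballot_code m z m1.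
- by rewrite zo; apply/andP; split; [rewrite so /= sw|].
- by rewrite zo so -(size_map snd) -/(unzip2 z) zo /= sw.
exists t; last by rewrite /opens ct zo.
by split=> //; rewrite symbols_code ct unzip1_zip // size_iota /= sw.
Qed.

Section Classes.
Import finmap boolp classical_sets cardinality.
Local Open Scope classical_set_scope.

Definition residue_class (m k n : nat) (w : seq nat) : set paren :=
  [set t | parens m n t /\ [seq a %% k | a <- behead (opens t)] = w].

(** Residues are invariant; conversely, trees with equal residues have normal forms with equal
    tails, which coincide by [parens_inj]. *)
Lemma kclassE (m k n : nat) (t : paren) : 1 < m -> 0 < k -> parens m n t ->
  parens m n `&` kequiv m k t =
  residue_class m k n [seq a %% k | a <- behead (opens t)].
Proof.
move=> m1 k0 pt; apply/seteqP; split=> u [pu].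
  by move=> tu; split=> //; rewrite -!behead_map (kequiv_opens_mod m1 k0 tu pt).
move=> e; split=> //.
have normal_mod v v' : kequiv m k v v' -> parens m n v ->
    all (fun a => a < k) (behead (opens v')) ->
    behead (opens v') = [seq a %% k | a <- behead (opens v)].
  move=> vv' pv av'; rewrite -behead_map (kequiv_opens_mod m1 k0 vv' pv) behead_map.
  by rewrite -[LHS]map_id; apply/eq_in_map => a /(allP av') /modn_small.
have [t' [tt' pt' at']] := normal_form m1 k0 pt.
have [u' [uu' pu' au']] := normal_form m1 k0 pu.
have tu' : t' = u'.
  by apply: parens_inj pt' pu' _; rewrite // (normal_mod _ _ tt') // (normal_mod _ _ uu').
by apply: rst_trans tt' _; rewrite tu'; apply: rst_sym.
Qed.

(** The index of a class is the tail of its normal form, a ballot word because a suffix of a ballot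
    word is one. *)
Lemma kclasses_words (m k n : nat) : 1 < m -> 0 < k -> 0 < n -> m.-1 %| n ->
  kclasses m k n =
  residue_class m k n @` [set` [seq w <- words k n | ballot m.-1 w]].
Proof.
move=> m1 k0 n0 dn; apply/seteqP; split=> [_ [t pt <-]|_ [w /= wW <-]].
  rewrite kclassE //; exists [seq a %% k | a <- behead (opens t)] => //=.
  have [u [tu pu au]] := normal_form m1 k0 pt.
  rewrite -behead_map (kequiv_opens_mod m1 k0 tu pt) behead_map.
  have -> : [seq a %% k | a <- behead (opens u)] = behead (opens u).
    by rewrite -[RHS]map_id; apply/eq_in_map => a /(allP au) /modn_small.
  rewrite mem_filter mem_words au size_behead (size_opens pu) eqxx !andbT.
  by have [_] := code_ballot m1 pu.1; case: (opens u) => [//|a s] /andP[].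
move: wW; rewrite mem_filter => /andP[bw wW].
have [t pt tw] := parens_of_word m1 n0 dn wW bw.
exists t => //; rewrite kclassE // tw; congr residue_class.
rewrite -[RHS]map_id; apply/eq_in_map => a aw; apply: modn_small.
by move: wW; rewrite mem_words => /andP[_ /allP]; apply.
Qed.

Lemma nb_kclasses_words (m k n : nat) : 1 < m -> 0 < k -> 0 < n -> m.-1 %| n ->
  nb_kclasses m k n = \sum_(w <- words k n) ballot m.-1 w.
Proof.
move=> m1 k0 n0 dn; rewrite /nb_kclasses kclasses_words //.
set W := filter _ _.
have -> : [set` W] = [set` [fset w in W]%fset].
  by apply/seteqP; split=> w /=; rewrite inE.
rewrite fset_set_image ?set_fsetK; last exact: finite_fset.
rewrite card_in_imfset /=; last first.
  (* Letters are below [k], so a tree with tail [w] lies in the class of [w] and recovers its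
     index. *)
  move=> w w'; rewrite !inE !mem_filter => /andP[bw wW] _ e.
  have [t pt tw] := parens_of_word m1 n0 dn wW bw.
  have : residue_class m k n w t.
    split=> //; rewrite tw -[RHS]map_id; apply/eq_in_map => a aw.
    by apply: modn_small; move: wW; rewrite mem_words => /andP[_ /allP]; apply.
  by move=> rw; have := rw; rewrite e => -[_ <-]; case: rw.
rewrite card_fseq undup_id ?filter_uniq ?uniq_words // size_filter.
by rewrite -sum1_count big_mkcond.
Qed.
End Classes.

(** * Summation over contents and the final formula *)

Lemma multinomialE (k n : nat) (e : 'I_k -> nat) : \sum_(i < k) e i = n ->
  multinomial n e =
  \sum_(w <- words k n) [forall i : 'I_k, count_mem (val i) w == e i].
Proof.
move=> /count_words_content; rewrite /multinomial => <-.
by rewrite mulnK // prodn_gt0 // => i; rewrite fact_gt0.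
Qed.

(** Each word has exactly one content. Here [e i] counts the letter [i] and plays the role of
    $m_{i+1}$, so the letter sum is $m_2+2m_3+\dots+(k-1)m_k$. *)
Lemma sum_words_multinomial (k n s : nat) :
  \sum_(w <- words k n) (sumn w == s) =
  \sum_(e : {ffun 'I_k -> 'I_n.+1} | (\sum_(i < k) e i == n) &&
                                     (\sum_(i < k) i * e i == s))
    multinomial n (fun i => e i).
Proof.
under [RHS]eq_bigr => e /andP[/eqP se _] do rewrite (multinomialE se).
rewrite exchange_big /=; apply: eq_big_seq => w.
rewrite mem_words => /andP[/eqP sw aw].
have lt (i : 'I_k) : count_mem (val i) w < n.+1 by rewrite ltnS -sw count_size.
pose c : {ffun 'I_k -> 'I_n.+1} := [ffun i => Ordinal (lt i)].
have cE (i : 'I_k) : c i = count_mem (val i) w :> nat by rewrite ffunE.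
have sc : \sum_(i < k) c i = n.
  under eq_bigr => i _ do rewrite cE -[count _ _]mul1n.
  by rewrite (sum_count_mem (fun=> 1) aw) sum1_size.
have mc : \sum_(i < k) i * c i = sumn w.
  under eq_bigr => i _ do rewrite cE.
  by rewrite (sum_count_mem id aw) sumnE.
rewrite big_mkcond (bigD1 c) //= sc mc eqxx /=.
rewrite (_ : [forall i, _] = true); last by apply/forallP => i; rewrite cE.
rewrite big1 ?addn0; first by case: eqP.
move=> e /eqP ne; case: ifP => // _; case: forallP => // he; case: ne.
by apply/ffunP => i; apply/val_inj; rewrite /= cE; apply/esym/eqP/he.
Qed.

(* [l] is [n - d * sumn w]. *)
Lemma sum_ballot_height (d k n : nat) : 0 < d -> 0 < n -> d %| n ->
  \sum_(w <- words k n) ballot d w =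
  \sum_(1 <= l < n.+1 | d %| l)
    \sum_(w <- words k n) ballot d w * (sumn w == (n - l) %/ d).
Proof.
move=> d0 n0 /dvdnP[q nE].
rewrite exchange_big /=; apply: eq_big_seq => w /size_words sw.
rewrite -big_distrr /=; case: (boolP (ballot d w)) => bw; last by rewrite mul0n.
have lt : d * sumn w < n.
  by case: w bw sw => [_ _|a w /andP[lt _] <- //]; rewrite /= muln0.
rewrite mul1n (big_rem (n - d * sumn w)) /=; last by rewrite mem_index_iota; lia.
have -> : d %| n - d * sumn w by rewrite nE mulnC -mulnBr dvdn_mulr.
rewrite subKn ?(ltnW lt) // mulKn // eqxx big1_seq // => l /andP[dl].
rewrite rem_filter ?iota_uniq // mem_filter mem_index_iota /= => /andP[nl lb].
case: eqP => // e; case/eqP: nl; rewrite e mulnC divnK; first by lia.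
by rewrite dvdn_sub // nE dvdn_mull.
Qed.

Local Open Scope ring_scope.

Theorem theorem1p2 (m k n : nat) (hm : (2 <= m)%N) (hk : (1 <= k)%N)
    (hn : (0 < n)%N) (hdiv : (m.-1 %| n)%N) :
  (nb_kclasses m k n)%:R =
    \sum_(1 <= l < n.+1 | (m.-1 %| l)%N)
      (l%:R / n%:R *
       \sum_(e : {ffun 'I_k -> 'I_n.+1} |
               ((\sum_(i < k) e i)%N == n)
               && ((\sum_(i < k) i * e i)%N == (n - l) %/ m.-1)%N)
         (multinomial n (fun i => e i))%:R) :> rat.
Proof.
have d0 : (0 < m.-1)%N by lia.
rewrite nb_kclasses_words // sum_ballot_height // natr_sum.
rewrite big_nat_cond [RHS]big_nat_cond; apply: eq_bigr => l /andP[/andP[l0 ln] dl].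
rewrite -natr_sum -sum_words_multinomial.
have n0 : n%:R != 0 :> rat by rewrite pnatr_eq0; lia.
(* Multiplying by [n] clears the fraction and gives the form of [sum_ballot_words]. *)
apply: (mulfI n0); rewrite mulrA mulrCA divff // mulr1 -!natrM; congr _%:R.
rewrite (sum_ballot_words _ _ _ (fun s => nat_of_bool (s == (n - l) %/ m.-1)%N)).
rewrite big_distrr /=; apply: eq_bigr => w _.
(* For words of this sum, the weight [n - m.-1 * sumn w] is exactly [l]. *)
case: eqP => [->|_]; last by rewrite !muln0.
by rewrite mulnC [(m.-1 * _)%N]mulnC divnK ?dvdn_sub // mulnC subKn.
Qed.
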